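(* (i) For $D\in(D_1,D_0)$, $\tilde E>V(z_{\min},D,\lambda)$ and $\lambda=C\lambda_{\text{thres}}=C\frac{\sqrt{mgR^3I_3\alpha}\,(1+\alpha)^2}{\sqrt{1+\alpha-\gamma}}$ with $C>1$, the period of oscillations $T$ behaves as $$T=\frac{2\pi\sqrt{g(z^* )}}{\sqrt{2mgR\alpha}}\sqrt{\frac{1-z_1^2}{1+w^2+2wz_1}}\,\sqrt{\epsilon}\,\big[1+O(\epsilon)\big]\qquad\text{as}\quad \epsilon=\frac{2\beta}{b^2}\to0 .$$ (ii) The leading factor is bounded: $$\frac{2\pi\sqrt{g(z^* )}}{\sqrt{2mgR\alpha}}\sqrt{\frac{1-z_1^2}{1+w^2+2wz_1}}\,\sqrt{\epsilon}\;\le\;\frac{2\pi RI_3\gamma(\alpha+1-\gamma)}{b}=:T_{\max}$$ for $(z_1,w)$ in any closed rectangle $[-1,1]\times[-1+\delta,1-\delta]$, $0<\delta<1$.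
   Context: The constants $m,g,R,I_1,I_3$ are positive real numbers ($g$ without argument is the gravitational acceleration), $0<\alpha<1$, $\gamma=I_1/I_3$, and it is assumed that $1-\alpha^2<\gamma<1$ and that $\sigma:=mR^2/I_3$ satisfies $\sigma=\frac{1-\gamma}{\gamma+\alpha^2-1}$. The effective potential is, for $z\in(-1,1)$, $$V(z,D,\lambda)=mgR(1-\alpha z)+\frac{\big(\lambda(\alpha-(1-\gamma)z)+RD\sqrt{\gamma+\alpha^2-1}\,(\alpha-z)\big)^2}{2I_3R^2\gamma^2(\gamma+\alpha^2-1)(1-z^2)}+\frac{R^2D^2(\gamma+\alpha^2-1)-(1-\gamma)\lambda^2}{2R^2I_1(\gamma+\alpha^2-1)},$$ and the function $g(\cdot)$ (with an argument) is $$g(z)=\frac{I_3\big(\alpha^2+(1-\gamma)^2-2\alpha(1-\gamma)z\big)}{2(\gamma+\alpha^2-1)}.$$ Here $$D_0=\frac{\lambda}{R(1-\alpha)}\frac{\alpha-1+\gamma}{\sqrt{\gamma+\alpha^2-1}},\qquad D_1=-\frac{\lambda}{R(1+\alpha)}\frac{\alpha+1-\gamma}{\sqrt{\gamma+\alpha^2-1}},$$ $$a=-(1-\gamma)\lambda-RD\sqrt{\gamma+\alpha^2-1},\qquad b=\alpha\lambda+\alpha RD\sqrt{\gamma+\alpha^2-1},\qquad w=\frac ab,$$ $$\beta=2mgR^3\alpha I_3\gamma^2(\gamma+\alpha^2-1).$$ For $D\in(D_1,D_0)$ and $\lambda>0$ one has $b>0$ and $|w|<1$, and $V(\cdot,D,\lambda)$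 is convex on $(-1,1)$, tends to $+\infty$ at $z=\pm1$, and has a unique minimum point $z_{\min}\in(-1,1)$. For $\tilde E>V(z_{\min},D,\lambda)$ the turning points $z_1<z_2$ in $(-1,1)$ are the two solutions of $\tilde E=V(z,D,\lambda)$. The period of oscillations within the potential is $$T=2\int_{z_1}^{z_2}\frac{\sqrt{g(z)}\,dz}{\sqrt{(1-z^2)(\tilde E-V(z,D,\lambda))}},$$ and $z^*\in[z_1,z_2]$ denotes the value given by the mean value theorem for integrals, i.e. $$T=2\sqrt{g(z^* )}\int_{z_1}^{z_2}\frac{dz}{\sqrt{(1-z^2)(\tilde E-V(z,D,\lambda))}}.$$ In the asymptotic statement the constants $m,g,R,\alpha,I_3,\gamma$ are fixed, and $T$ is regarded as a function of $\epsilon=2\beta/b^2$ and of the parameters $w$ and $z_1$ (the left turning point, used in place of $\tilde E$); $w$ and $z_1$ are held fixed as $\epsilon\to0$. (Note $b+\alpha a=\lambda\gamma\alpha$, so $\epsilon\to0$ with $w$ fixed means $\lambda\to\infty$.) *)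

(* Defs.v *)
From mathcomp Require Import all_boot all_order all_algebra.
From mathcomp Require Import all_classical all_reals all_analysis.
Set Implicit Arguments.
Unset Strict Implicit.
Unset Printing Implicit Defensive.
Import Order.TTheory GRing.Theory Num.Theory.
Import numFieldNormedType.Exports.
Local Open Scope classical_set_scope.
Local Open Scope ring_scope.

(* The constants m, g, R, I_1, I_3, alpha of the tippe top; no constraint is
   built in. *)
Record top_constants (R : realType) := TopConstants {
  mass : R;
  grav : R;
  top_radius : R;
  inertia1 : R;
  inertia3 : R;
  alpha : R }.

Definition gamma (R : realType) (p : top_constants R) : R :=
  inertia1 p / inertia3 p.

Definition sigma (R : realType) (p : top_constants R) : R :=
  mass p * top_radius p ^+ 2 / inertia3 p.

Definition kappa (R : realType) (p : top_constants R) : R :=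
  gamma p + alpha p ^+ 2 - 1.

Definition V (R : realType) (p : top_constants R) (z D lambda : R) : R :=
  mass p * grav p * top_radius p * (1 - alpha p * z)
  + (lambda * (alpha p - (1 - gamma p) * z)
     + top_radius p * D * Num.sqrt (kappa p) * (alpha p - z)) ^+ 2
    / (2 * inertia3 p * top_radius p ^+ 2 * gamma p ^+ 2 * kappa p
       * (1 - z ^+ 2))
  + (top_radius p ^+ 2 * D ^+ 2 * kappa p - (1 - gamma p) * lambda ^+ 2)
    / (2 * top_radius p ^+ 2 * inertia1 p * kappa p).

(* The function g(z), not to be confused with the acceleration [grav]. *)
Definition gfun (R : realType) (p : top_constants R) (z : R) : R :=
  inertia3 p
  * (alpha p ^+ 2 + (1 - gamma p) ^+ 2 - 2 * alpha p * (1 - gamma p) * z)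
  / (2 * kappa p).

Definition D0 (R : realType) (p : top_constants R) (lambda : R) : R :=
  lambda / (top_radius p * (1 - alpha p))
  * ((alpha p - 1 + gamma p) / Num.sqrt (kappa p)).

Definition D1 (R : realType) (p : top_constants R) (lambda : R) : R :=
  - (lambda / (top_radius p * (1 + alpha p))
     * ((alpha p + 1 - gamma p) / Num.sqrt (kappa p))).

Definition acoef (R : realType) (p : top_constants R) (D lambda : R) : R :=
  - (1 - gamma p) * lambda - top_radius p * D * Num.sqrt (kappa p).

Definition bcoef (R : realType) (p : top_constants R) (D lambda : R) : R :=
  alpha p * lambda + alpha p * top_radius p * D * Num.sqrt (kappa p).

Definition wratio (R : realType) (p : top_constants R) (D lambda : R) : R :=
  acoef p D lambda / bcoef p D lambda.

Definition beta (R : realType) (p : top_constants R) : R :=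
  2 * mass p * grav p * top_radius p ^+ 3 * alpha p * inertia3 p
  * gamma p ^+ 2 * kappa p.

Definition epsilon (R : realType) (p : top_constants R) (D lambda : R) : R :=
  2 * beta p / bcoef p D lambda ^+ 2.

Definition lambda_thres (R : realType) (p : top_constants R) : R :=
  Num.sqrt (mass p * grav p * top_radius p ^+ 3 * inertia3 p * alpha p)
  * (1 + alpha p) ^+ 2 / Num.sqrt (1 + alpha p - gamma p).

Definition is_minimum_point (R : realType) (p : top_constants R)
    (D lambda zmin : R) : Prop :=
  -1 < zmin < 1 /\ forall z, -1 < z < 1 -> V p zmin D lambda <= V p z D lambda.

Definition turning_points (R : realType) (p : top_constants R)
    (D lambda E z1 z2 : R) : Prop :=
  [/\ -1 < z1, z1 < z2, z2 < 1 &
      forall z, -1 < z < 1 -> (E = V p z D lambda <-> z = z1 \/ z = z2)].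

(* The integrands below are nonnegative and blow up at z1 and z2, so the
   improper integrals are Lebesgue integrals; the values at the endpoints
   (0 since x / 0 = 0) do not matter. *)
Definition period (R : realType) (p : top_constants R)
    (D lambda E z1 z2 : R) : R :=
  2 * \int[@lebesgue_measure R]_(z in `[z1, z2])
        (Num.sqrt (gfun p z)
         / Num.sqrt ((1 - z ^+ 2) * (E - V p z D lambda))).

(* [zs] is a value z^* provided by the mean value theorem for integrals; it is
   unique, since g is injective when alpha (1 - gamma) <> 0. *)
Definition mean_value_point (R : realType) (p : top_constants R)
    (D lambda E z1 z2 zs : R) : Prop :=
  z1 <= zs <= z2 /\
  period p D lambda E z1 z2 =
    2 * Num.sqrt (gfun p zs)
    * \int[@lebesgue_measure R]_(z in `[z1, z2])
        (Num.sqrt ((1 - z ^+ 2) * (E - V p z D lambda)))^-1.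

Definition leading_factor (R : realType) (p : top_constants R)
    (zs z1 w eps : R) : R :=
  2 * pi * Num.sqrt (gfun p zs)
  / Num.sqrt (2 * mass p * grav p * top_radius p * alpha p)
  * Num.sqrt ((1 - z1 ^+ 2) / (1 + w ^+ 2 + 2 * w * z1))
  * Num.sqrt eps.

Definition T_max (R : realType) (p : top_constants R) (D lambda : R) : R :=
  2 * pi * top_radius p * inertia3 p * gamma p * (alpha p + 1 - gamma p)
  / bcoef p D lambda.

(* Main.v *)
(* With eta = (eps / 2) (1 - z1^2) / (1 + w^2 + 2 w z1) and M = m g R alpha,
   clearing denominators turns (1 - z^2) (E - V(z)) into
     (M / eta) (z - z1) (z2 - z) (1 + eta (z + z2)).
   The last factor lies between 1 - 2 eta and 1 + 2 eta, and the integral of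
   1 / sqrt ((z - z1) (z2 - z)) over [z1, z2] is pi, so the period is
   2 pi sqrt (g(zs)) sqrt (eta / M), which is the leading factor, up to a
   relative error of at most 2 eta = O(eps). *)
Require Import Defs.
From mathcomp Require Import all_boot all_order all_algebra.
From mathcomp Require Import all_classical all_reals all_analysis.
From mathcomp Require Import measurable_realfun ring lra.
Set Implicit Arguments.
Unset Strict Implicit.
Unset Printing Implicit Defensive.
Import Order.TTheory GRing.Theory Num.Theory.
Import numFieldNormedType.Exports.
Local Open Scope classical_set_scope.
Local Open Scope ring_scope.

(** * The arcsine integral over an interval, and integrals comparable to it *)

Section ArcsineIntegral.
Context {R : realType}.
Local Notation mu := (@lebesgue_measure R).

Lemma continuous_sqrtV (f : R -> R) (x : R) : 0 < f x ->
  {for x, continuous f} ->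
  {for x, continuous (fun y => (Num.sqrt (f y))^-1)}.
Proof.
move=> fx cf; apply: cvgV; first by rewrite gt_eqF// sqrtr_gt0.
by apply: continuous_comp => //; exact: sqrt_continuous.
Qed.

(** Continuity on the open interval is enough: the endpoints, where [f] may vanish, do not affect
    measurability. *)
Lemma measurable_sqrtV (f : R -> R) (a b : R) : continuous f ->
  (forall x, a < x < b -> 0 < f x) ->
  measurable_fun `[a, b] (fun y => (Num.sqrt (f y))^-1).
Proof.
move=> cf f_gt0; apply: measurable_fun_itv_cc.
apply: open_continuous_measurable_fun.
  exact: (@interval_open R (BRight a) (BLeft b)).
move=> x; rewrite inE/= in_itv/= => xab.
by apply: continuous_sqrtV; [exact: f_gt0|exact: cf].
Qed.

(* The endpoints are cosines so that the arcsine primitive is explicit there: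
   its continuity at 1 and -1 is not needed in the limit t -> 0. *)
Lemma integral_arcsine_trunc (m r t : R) : 0 < r -> 0 < t < pi / 2 ->
  (\int[mu]_(x in `[(m - r * cos t)%R, (m + r * cos t)%R])
      ((Num.sqrt (r ^+ 2 - (x - m) ^+ 2))^-1)%R%:E = (pi - 2 * t)%R%:E)%E.
Proof.
move=> r0 /andP[t0 tpi].
have c0 : 0 < cos t by apply: cos_gt0_pihalf; lra.
have c1 : cos t < 1.
  by rewrite -cos0 ltr_cos// in_itv/=; apply/andP; split; lra.
pose F x := asin ((x - m) / r).
have in01 x : m - r * cos t <= x <= m + r * cos t -> -1 < (x - m) / r < 1.
  by move=> /andP[? ?]; rewrite ltr_pdivlMr// ltr_pdivrMr//; nra.
have pos x : m - r * cos t <= x <= m + r * cos t -> 0 < r ^+ 2 - (x - m) ^+ 2.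
  by move=> /in01; rewrite ltr_pdivlMr// ltr_pdivrMr// => /andP[? ?]; nra.
have dF x : m - r * cos t <= x <= m + r * cos t ->
    is_derive x 1 F (Num.sqrt (r ^+ 2 - (x - m) ^+ 2))^-1.
  move=> xI.
  have d1 : is_derive ((x - m) / r) 1 asin (Num.sqrt (1 - ((x - m) / r) ^+ 2))^-1.
    exact: is_derive1_asin (in01 _ xI).
  have d2 : is_derive x 1 (fun y : R => (y - m) / r) r^-1.
    have -> : (fun y : R => (y - m) / r) = r^-1 *: (id - cst m) :> (R -> R).
      by apply/funext => y /=; rewrite fctE/= mulrC.
    by apply: is_derive_eq; rewrite subr0 scaler1.
  have := @is_derive1_comp _ _ (fun y : R => (y - m) / r) _ _ _ d1 d2; rewrite -invfM.
  have -> // : Num.sqrt (1 - ((x - m) / r) ^+ 2) * r =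
      Num.sqrt (r ^+ 2 - (x - m) ^+ 2).
  rewrite -[X in _ * X](gtr0_norm r0) -sqrtr_sqr mulrC -sqrtrM ?sqr_ge0//.
  by congr Num.sqrt; field; rewrite gt_eqF.
have aSb : m - r * cos t < m + r * cos t by nra.
rewrite (@continuous_FTC2 _ _ F) => //.
- rewrite /F -EFinB; congr (_%:E).
  have r_neq0 : r != 0 by rewrite gt_eqF.
  have -> : (m + r * cos t - m) / r = cos t by field.
  have -> : (m - r * cos t - m) / r = - cos t by field.
  (* Since pi / 2 - t lies in the range of [asin], the primitive takes the values pi / 2 - t and -
     (pi / 2 - t) at the two ends. *)
  have -> : cos t = sin (pi / 2 - t) by rewrite -opprB sinN sinBpihalf opprK.
  rewrite -sinN !sinK ?in_itv/=; [lra|apply/andP; split; lra..].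
- apply: continuous_in_subspaceT => x; rewrite inE/= in_itv/= => xI.
  apply: (@continuous_sqrtV (fun y => r ^+ 2 - (y - m) ^+ 2)); first exact: pos.
  apply: cvgB; first exact: cvg_cst.
  by apply: cvgM; apply: cvgB => //; exact: cvg_cst.
- have dF' : {in `[m - r * cos t, m + r * cos t], forall x, derivable F x 1}.
    by move=> x; rewrite in_itv/= => /dF[].
  have /continuous_within_itvP -/(_ aSb)[_ ? ?] := derivable_within_continuous dF'.
  by split => // x xI; apply: dF'; exact: subset_itv_oo_cc xI.
- move=> x; rewrite in_itv/= => /andP[? ?]; rewrite derive1E.
  have xI : m - r * cos t <= x <= m + r * cos t by apply/andP; split; exact: ltW.
  by have := dF _ xI => ?; rewrite derive_val.
Qed.

(** The truncated intervals [F n] increase to the open interval, so by monotone convergence the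
    integral is the limit of pi - 2 [t n], where [t n] tends to 0. *)
Lemma integral_arcsine (a b : R) : a < b ->
  (\int[mu]_(x in `[a, b]) ((Num.sqrt ((x - a) * (b - x)))^-1)%R%:E = pi%R%:E)%E.
Proof.
move=> ab; pose m := (a + b) / 2; pose r := (b - a) / 2.
have r0 : 0 < r by rewrite divr_gt0// subr_gt0.
pose f (x : R) := (Num.sqrt (r ^+ 2 - (x - m) ^+ 2))^-1.
have fE x : (Num.sqrt ((x - a) * (b - x)))^-1 = f x.
  by rewrite /f; congr (Num.sqrt _)^-1; rewrite /r /m; field.
under eq_integral do rewrite fE.
have cq : continuous (fun x : R => r ^+ 2 - (x - m) ^+ 2).
  move=> x; apply: cvgB; first exact: cvg_cst.
  by apply: cvgM; apply: cvgB => //; exact: cvg_cst.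
have mf : measurable_fun `[a, b] f.
  apply: (measurable_sqrtV cq) => x /andP[ax xb].
  by have -> : r ^+ 2 - (x - m) ^+ 2 = (x - a) * (b - x);
    [rewrite /r /m; field | rewrite mulr_gt0// subr_gt0].
(* The shift by two gives [t n] < 1 <= pi / 2 already for n = 0. *)
pose t (n : nat) : R := n.+2%:R^-1.
have tpi n : 0 < t n < pi / 2.
  rewrite invr_gt0 ltr0n/=; apply: (lt_le_trans _ (pihalf_ge1 R)).
  by rewrite invf_lt1// ltr1n.
have t0pi n : t n \in `[0, pi].
  by have /andP[? ?] := tpi n; rewrite in_itv/=; apply/andP; split; lra.
have t_cvg : t @ \oo --> 0.
  have := @cvg_harmonic R; rewrite -cvg_shiftS; exact.
have cos1 n : cos (t n) < 1.
  rewrite -cos0 ltr_cos//; last by rewrite in_itv/= lexx pi_ge0.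
  by have /andP[] := tpi n.
pose F n : set R := `[m - r * cos (t n), m + r * cos (t n)]%classic.
have FS n : F n `<=` `]a, b[.
  move=> x; rewrite /F/= !in_itv/= => /andP[xF Fx].
  have rc : r * cos (t n) < r by rewrite gtr_pMr.
  by move: rc xF Fx; rewrite /m /r => rc xF Fx; apply/andP; split; lra.
have ndF : nondecreasing_seq F.
  apply/nondecreasing_seqP => n; rewrite subsetEset => x.
  rewrite /F/= !in_itv/= => /andP[mx xm].
  have c_lt : cos (t n) < cos (t n.+1).
    by rewrite ltr_cos// ltf_pV2 ?posrE// ltr_nat.
  by apply/andP; split; nra.
have UF : \bigcup_n F n = `]a, b[%classic.
  apply/seteqP; split=> [x [n _ /FS//]|x]; rewrite /= in_itv/= => /andP[ax xb].
  (* A point of the open interval lies in [F n] as soon as cos ([t n]) exceeds [y] < 1, which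
     happens since cos ([t n]) tends to 1. *)
  pose y := `|x - m| / r.
  have y1 : y < 1.
    by rewrite ltr_pdivrMr// mul1r ltr_norml /r /m; apply/andP; split; lra.
  have cos_cvg : cos (t n) @[n --> \oo] --> (1 : R).
    by rewrite -cos0; apply: cvg_comp t_cvg _; exact: continuous_cos.
  near \oo => n.
  have yc : y < cos (t n) by near: n; exact: (cvgr_gt _ cos_cvg).
  exists n => //; rewrite /F/= in_itv/= -ler_distl.
  by move: yc; rewrite ltr_pdivrMr// mulrC => /ltW.
have cvg1 : (\int[mu]_(x in F n) (f x)%:E @[n --> \oo] -->
    \int[mu]_(x in `]a, b[) (f x)%:E)%E.
  rewrite -UF; apply: ge0_nondecreasing_set_cvg_integral => //.
  + by move=> n; exact: measurable_itv.
  + move=> n; apply/measurable_EFinP; apply: measurable_funS mf => //.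
    by move=> x /FS; exact: subset_itv_oo_cc.
  + by move=> n x _; rewrite lee_fin invr_ge0 sqrtr_ge0.
have cvg2 : (\int[mu]_(x in F n) (f x)%:E @[n --> \oo] --> pi%:E)%E.
  under eq_cvg do rewrite integral_arcsine_trunc//.
  apply: cvg_EFin; first exact: nearW.
  rewrite -[X in _ --> X]subr0 -[X in _ - X](mulr0 2).
  by apply: cvgB; [exact: cvg_cst|apply: cvgM => //; exact: cvg_cst].
rewrite integral_itv_bndoo; last first.
  apply/measurable_EFinP; apply: measurable_funS mf => //.
  exact: subset_itv_oo_cc.
by rewrite -(cvg_unique _ cvg1 cvg2).
Unshelve. all: by end_near. Qed.

(** The integrand is the arcsine density [k] divided by sqrt q, hence lies between [k] / sqrt hi and
    [k] / sqrt lo, and [k] has integral pi. The upper bound also dominates it, which gives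
    integrability; this is needed later to take constants out of the real-valued integral. *)
Lemma arcsine_weight_bounds (a b lo hi : R) (q : R -> R) : a < b ->
  continuous q -> 0 < lo -> (forall x, a <= x <= b -> lo <= q x <= hi) ->
  let J := \int[mu]_(x in `[a, b]) (Num.sqrt ((x - a) * (b - x) * q x))^-1 in
  mu.-integrable `[a, b]
    (EFin \o (fun x => (Num.sqrt ((x - a) * (b - x) * q x))^-1)) /\
  pi / Num.sqrt hi <= J <= pi / Num.sqrt lo.
Proof.
move=> ab cq lo0 qI.
have hi0 : 0 < hi.
  have /qI/andP[loq qhi] : a <= a <= b by rewrite lexx ltW.
  exact: lt_le_trans (lt_le_trans lo0 loq) qhi.
pose k (x : R) := (Num.sqrt ((x - a) * (b - x)))^-1.
have cp : continuous (fun x : R => (x - a) * (b - x)).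
  by move=> x; apply: cvgM; apply: cvgB => //; exact: cvg_cst.
have p_gt0 x : a < x < b -> 0 < (x - a) * (b - x).
  by move=> /andP[ax xb]; rewrite mulr_gt0// subr_gt0.
have mk : measurable_fun `[a, b] k by apply: measurable_sqrtV cp _.
have ik : mu.-integrable `[a, b] (EFin \o k).
  apply/integrableP; split; first exact/measurable_EFinP.
  under eq_integral => x _ do
    rewrite /= ger0_norm ?invr_ge0 ?sqrtr_ge0//.
  by rewrite integral_arcsine// ltry.
have Jk : \int[mu]_(x in `[a, b]) k x = pi by rewrite /Rintegral integral_arcsine.
have ikZ c : mu.-integrable `[a, b] (EFin \o (fun x => k x / c)).
  have := @integrableZr _ _ _ mu _ (measurable_itv `[a, b]) c^-1 _ ik.
  by apply: eq_integrable.
have pq x : a <= x <= b ->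
    (Num.sqrt ((x - a) * (b - x) * q x))^-1 = k x / Num.sqrt (q x).
  by move=> /andP[ax xb]; rewrite sqrtrM ?invfM// mulr_ge0// subr_ge0.
have k_ge0 x : 0 <= k x by rewrite invr_ge0 sqrtr_ge0.
have q_gt0 x : a <= x <= b -> 0 < q x.
  by move=> /qI/andP[loq _]; exact: lt_le_trans loq.
have qlo x : a <= x <= b -> k x / Num.sqrt (q x) <= k x / Num.sqrt lo.
  move=> xab; have /andP[loq _] := qI _ xab.
  by rewrite ler_wpM2l// lef_pV2 ?posrE ?sqrtr_gt0 ?q_gt0// ler_wsqrtr.
have qhi x : a <= x <= b -> k x / Num.sqrt hi <= k x / Num.sqrt (q x).
  move=> xab; have /andP[_ qhi] := qI _ xab.
  by rewrite ler_wpM2l// lef_pV2 ?posrE ?sqrtr_gt0 ?q_gt0// ler_wsqrtr.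
have iJ : mu.-integrable `[a, b]
    (EFin \o (fun x => (Num.sqrt ((x - a) * (b - x) * q x))^-1)).
  apply: (le_integrable _ _ _ (ikZ (Num.sqrt lo))) => //.
    apply/measurable_EFinP.
    apply: (@measurable_sqrtV (fun x => (x - a) * (b - x) * q x)).
      by move=> x; apply: cvgM; [exact: cp|exact: cq].
    move=> x xab; apply: mulr_gt0; first exact: p_gt0.
    by apply: q_gt0; case/andP: xab => /ltW-> /ltW->.
  move=> x /=; rewrite in_itv/= => xab; rewrite lee_fin pq//.
  rewrite !ger0_norm ?qlo// divr_ge0// sqrtr_ge0.
move=> J; split=> //; apply/andP; split.
- rewrite -Jk -RintegralZr//; apply: le_Rintegral => // x.
  by rewrite /= in_itv/= => xab; rewrite pq// qhi.
- rewrite -Jk -RintegralZr//; apply: le_Rintegral => // x.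
  by rewrite /= in_itv/= => xab; rewrite pq// qlo.
Qed.

End ArcsineIntegral.

(** * Algebra of the radicand in the period integral *)

Section Radicand.
Context {F : realFieldType}.
Implicit Types P M w eps z : F.

Lemma shape_gt0 w z : -1 < z < 1 -> 0 < 1 + w ^+ 2 + 2 * w * z.
Proof.
move=> /andP[? ?].
have -> : 1 + w ^+ 2 + 2 * w * z = (w + z) ^+ 2 + (1 - z) * (1 + z) by ring.
by apply: ltr_wpDl; [exact: sqr_ge0|apply: mulr_gt0; lra].
Qed.

Lemma one_sub_sqr_gt0 z : -1 < z < 1 -> 0 < 1 - z ^+ 2.
Proof. by move=> /andP[? ?]; nra. Qed.

(** The denominator exceeds the numerator by the square (w + z)^2. *)
Lemma shape_ratio_bounds w z : -1 <= z <= 1 -> 0 < 1 + w ^+ 2 + 2 * w * z ->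
  0 <= (1 - z ^+ 2) / (1 + w ^+ 2 + 2 * w * z) <= 1.
Proof.
move=> /andP[? ?] S0; rewrite divr_ge0 ?(ltW S0)//=; last by nra.
rewrite ler_pdivrMr// mul1r -subr_ge0.
have -> : 1 + w ^+ 2 + 2 * w * z - (1 - z ^+ 2) = (w + z) ^+ 2 by ring.
exact: sqr_ge0.
Qed.

(* Once z - z1 is divided out, [U z1 = U z2] says that z2 is a root of the
   remaining quadratic ([key] below). *)
Lemma radicand_factor P M w eps z1 z2 z :
  let U x := P - M * x + 2 * M / eps * ((1 + w * x) ^+ 2 / (1 - x ^+ 2)) in
  let eta := (1 - z1 ^+ 2) / (1 + w ^+ 2 + 2 * w * z1) * eps / 2 in
  0 < M -> 0 < eps -> -1 < z1 < 1 -> -1 < z2 < 1 -> -1 < z < 1 -> z1 != z2 ->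
  U z1 = U z2 ->
  (1 - z ^+ 2) * (U z1 - U z) =
  M / eta * ((z - z1) * (z2 - z) * (1 + eta * (z + z2))).
Proof.
move=> U eta M0 eps0 z1I z2I zI z12 U12.
have S0 : 1 + w ^+ 2 + 2 * w * z1 != 0 by rewrite gt_eqF// shape_gt0.
have d1 : 1 - z1 ^+ 2 != 0 by rewrite gt_eqF// one_sub_sqr_gt0.
have d2 : 1 - z2 ^+ 2 != 0 by rewrite gt_eqF// one_sub_sqr_gt0.
have d : 1 - z ^+ 2 != 0 by rewrite gt_eqF// one_sub_sqr_gt0.
have e0 : eps != 0 by rewrite gt_eqF.
have M_neq0 : M != 0 by rewrite gt_eqF.
have key : eps * (1 - z1 ^+ 2) * (1 - z2 ^+ 2) =
    2 * (2 * w + (1 + w ^+ 2) * (z1 + z2) + 2 * w * z1 * z2).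
  have z21 : z2 - z1 != 0 by rewrite subr_eq0 eq_sym.
  apply: (mulIf z21); apply: (mulIf M_neq0).
  apply/eqP; rewrite -subr_eq0; apply/eqP.
  transitivity ((U z1 - U z2) * (eps * (1 - z1 ^+ 2) * (1 - z2 ^+ 2))).
    by rewrite /U; field; apply/and3P.
  by rewrite U12 subrr mul0r.
(* The same division as in [key], now with z in place of z2; the cofactor of z - z1 is a quadratic
   in z. *)
have -> : (1 - z ^+ 2) * (U z1 - U z) = M * (z - z1) / (eps * (1 - z1 ^+ 2)) *
   (eps * (1 - z1 ^+ 2) * (1 - z ^+ 2)
    - 2 * (2 * w + (1 + w ^+ 2) * (z1 + z) + 2 * w * z1 * z)).
  by rewrite /U; field; apply/and3P.
(* Subtracting from this quadratic its value at z2, which is 0 by [key], exposes the factor z2 -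
   z. *)
have -> : eps * (1 - z1 ^+ 2) * (1 - z ^+ 2)
    - 2 * (2 * w + (1 + w ^+ 2) * (z1 + z) + 2 * w * z1 * z) =
  eps * (1 - z1 ^+ 2) * (z2 ^+ 2 - z ^+ 2)
    + 2 * (1 + w ^+ 2 + 2 * w * z1) * (z2 - z).
  by rewrite -[RHS]addr0 -(subrr (eps * (1 - z1 ^+ 2) * (1 - z2 ^+ 2))) {2}key; ring.
by rewrite /eta; field; apply/and3P.
Qed.

End Radicand.

(** * Normal form of the potential, bound on the leading factor, and the period *)

Section Top.
Context {R : realType} (p : top_constants R).
Hypotheses (mass_gt0 : 0 < mass p) (grav_gt0 : 0 < grav p).
Hypotheses (radius_gt0 : 0 < top_radius p) (I3_gt0 : 0 < inertia3 p).
Hypotheses (alpha_gt0 : 0 < alpha p) (gamma_gt0 : 0 < gamma p).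
Hypothesis kappa_gt0 : 0 < kappa p.
Implicit Types D lambda z w : R.

(** [M] is minus the slope of the gravitational term of [V], and [K] the constant in the denominator
    of its quadratic term. *)
Let M := mass p * grav p * top_radius p * alpha p.
Let K := 2 * inertia3 p * top_radius p ^+ 2 * gamma p ^+ 2 * kappa p.

Let M_gt0 : 0 < M. Proof. by rewrite !mulr_gt0. Qed.
Let K_gt0 : 0 < K. Proof. by rewrite !(gamma_gt0, exprn_gt0, mulr_gt0). Qed.

Lemma betaE : beta p = M * K. Proof. by rewrite /beta /M /K; ring. Qed.

(** The squared linear form in [V] is b + a z = b (1 + w z), and b^2 / K = 2 M / epsilon because
    beta = M K. The constant P stays anonymous since only differences of potentials enter the
    radicand. *)
Lemma V_wratioE D lambda : bcoef p D lambda != 0 -> exists P, forall z,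
  V p z D lambda = P - M * z + 2 * M / epsilon p D lambda *
    ((1 + wratio p D lambda * z) ^+ 2 / (1 - z ^+ 2)).
Proof.
move=> b0.
exists (mass p * grav p * top_radius p
  + (top_radius p ^+ 2 * D ^+ 2 * kappa p - (1 - gamma p) * lambda ^+ 2)
    / (2 * top_radius p ^+ 2 * inertia1 p * kappa p)) => z.
rewrite /V -/K.
have -> : lambda * (alpha p - (1 - gamma p) * z)
     + top_radius p * D * Num.sqrt (kappa p) * (alpha p - z) =
   bcoef p D lambda * (1 + wratio p D lambda * z).
  transitivity (bcoef p D lambda + acoef p D lambda * z).
    by rewrite /acoef /bcoef; ring.
  by rewrite -[acoef p D lambda](divfK b0) -/(wratio p D lambda); ring.
have -> : 2 * M / epsilon p D lambda = bcoef p D lambda ^+ 2 / K.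
  rewrite /epsilon betaE; field.
  by rewrite b0 !gt_eqF.
by rewrite exprMn invfM mulrACA /M; ring.
Qed.

(** Gathers the square roots into one, of rho eps / (2 M) = eta / M, the form in which the factor
    arises from the period integral. *)
Lemma leading_factorE zs z1 w eps :
  0 <= (1 - z1 ^+ 2) / (1 + w ^+ 2 + 2 * w * z1) ->
  leading_factor p zs z1 w eps = 2 * pi * Num.sqrt (gfun p zs) *
    Num.sqrt ((1 - z1 ^+ 2) / (1 + w ^+ 2 + 2 * w * z1) * eps / (2 * M)).
Proof.
move=> rho_ge0.
rewrite /leading_factor; set rho := (1 - z1 ^+ 2) / _.
have -> : 2 * mass p * grav p * top_radius p * alpha p = 2 * M by rewrite /M; ring.
have M2 : 0 <= (2 * M)^-1 by rewrite invr_ge0 mulr_ge0// ltW.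
rewrite -(mulrA rho) (mulrC eps) (sqrtrM _ rho_ge0) (sqrtrM _ M2) sqrtrV.
  by ring.
by rewrite -invr_ge0.
Qed.

(** After cancelling 2 pi and squaring, the left side is rho (I3 R gamma / b)^2 times an affine
    function of zs with nonpositive slope. There rho <= 1, and at zs = -1 the affine function equals
    (alpha + 1 - gamma)^2. *)
Lemma leading_factor_le_T_max zs z1 w lambda D :
  alpha p < 1 -> gamma p < 1 -> -1 <= z1 <= 1 -> -1 < w < 1 -> -1 <= zs <= 1 ->
  0 < lambda -> D1 p lambda < D ->
  leading_factor p zs z1 w (epsilon p D lambda) <= T_max p D lambda.
Proof.
move=> alpha_lt1 gamma_lt1 z1I wI zsI lambda_gt0 D1D.
have b_gt0 : 0 < bcoef p D lambda.
  have k0 : 0 < Num.sqrt (kappa p) by rewrite sqrtr_gt0.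
  have := D1D; rewrite /D1 -subr_gt0.
  set x := (X in 0 < X) => x0.
  (* Here [x] is D - D1; at D = D1 the coefficient b equals alpha lambda gamma / (1 + alpha). *)
  have -> : bcoef p D lambda =
      alpha p * (top_radius p * Num.sqrt (kappa p) * x
                 + lambda * gamma p / (1 + alpha p)).
    rewrite /x /bcoef; field.
    by rewrite !gt_eqF// addr_gt0.
  apply: mulr_gt0 => //; apply: addr_gt0; first by rewrite !mulr_gt0.
  by rewrite divr_gt0 ?addr_gt0// mulr_gt0.
(* [shape_gt0] excludes z1 = 1 and z1 = -1; here positivity comes from |w| < 1, the expression being
   at least (1 - |w|)^2. *)
have S_gt0 : 0 < 1 + w ^+ 2 + 2 * w * z1.
  by move: wI z1I => /andP[? ?] /andP[? ?]; have [w0|w0] := leP 0 w; nra.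
have c_ge0 : 0 <= alpha p * (1 - gamma p).
  by rewrite mulr_ge0 ?(ltW alpha_gt0)// subr_ge0 ltW.
move: zsI => /andP[zs1 zs2].
have n_ge0 : 0 <= alpha p ^+ 2 + (1 - gamma p) ^+ 2
                  - 2 * alpha p * (1 - gamma p) * zs.
  by have := sqr_ge0 (alpha p - (1 - gamma p)); nra.
have /andP[rho_ge0 rho_le1] := shape_ratio_bounds z1I S_gt0.
rewrite leading_factorE//; set rho := (1 - z1 ^+ 2) / _ in rho_ge0 rho_le1 *.
have -> : T_max p D lambda =
    2 * pi * (top_radius p * inertia3 p * gamma p * (alpha p + 1 - gamma p)
              / bcoef p D lambda).
  by rewrite /T_max !mulrA.
rewrite -mulrA ler_pM2l ?mulr_gt0 ?pi_gt0// -sqrtrM; last first.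
  by rewrite divr_ge0 ?(ltW kappa_gt0) ?mulr_ge0 ?(ltW I3_gt0)// ltW.
set y := (X in _ <= X).
have y_ge0 : 0 <= y.
  have last_ge0 : 0 <= alpha p + 1 - gamma p.
    by rewrite -addrA addr_ge0 ?(ltW alpha_gt0)// subr_ge0 ltW.
  by rewrite divr_ge0 ?(ltW b_gt0)// !(ltW gamma_gt0, last_ge0, mulr_ge0)// ltW.
rewrite -[y]ger0_norm// -sqrtr_sqr ler_wsqrtr//.
have -> : gfun p zs * (rho * epsilon p D lambda / (2 * M)) =
   rho * ((inertia3 p * top_radius p * gamma p / bcoef p D lambda) ^+ 2
    * (alpha p ^+ 2 + (1 - gamma p) ^+ 2 - 2 * alpha p * (1 - gamma p) * zs)).
  rewrite /epsilon betaE /gfun /K; field.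
  by rewrite !gt_eqF.
have -> : y ^+ 2 = (inertia3 p * top_radius p * gamma p / bcoef p D lambda) ^+ 2
    * (alpha p ^+ 2 + (1 - gamma p) ^+ 2 + 2 * alpha p * (1 - gamma p)).
  by rewrite /y; field; rewrite gt_eqF.
apply: (@le_trans _ _ (1 * ((inertia3 p * top_radius p * gamma p / bcoef p D lambda) ^+ 2
    * (alpha p ^+ 2 + (1 - gamma p) ^+ 2 - 2 * alpha p * (1 - gamma p) * zs)))).
  by rewrite ler_wpM2r// mulr_ge0// sqr_ge0.
by rewrite mul1r ler_wpM2l ?sqr_ge0//; nra.
Qed.

(** The mean value point takes g out of the integral. The factored radicand then splits off sqrt
    (eta / M), which yields the leading factor, and leaves an arcsine integral with weight 1 + eta
    (z + z2). As |z + z2| <= 2, that weight stays within 2 eta of 1, and 2 eta < 1 keeps it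
    positive. *)
Lemma period_turning_points w z1 eps lambda D E z2 zs :
  let rho := (1 - z1 ^+ 2) / (1 + w ^+ 2 + 2 * w * z1) in
  let eta := rho * eps / 2 in
  0 < eps -> epsilon p D lambda = eps -> wratio p D lambda = w ->
  turning_points p D lambda E z1 z2 -> mean_value_point p D lambda E z1 z2 zs ->
  2 * eta < 1 ->
  period p D lambda E z1 z2 = leading_factor p zs z1 w eps *
    (\int[@lebesgue_measure R]_(z in `[z1, z2])
      (Num.sqrt ((z - z1) * (z2 - z) * (1 + eta * (z + z2))))^-1 / pi) /\
  (Num.sqrt (1 + 2 * eta))^-1 <=
    \int[@lebesgue_measure R]_(z in `[z1, z2])
      (Num.sqrt ((z - z1) * (z2 - z) * (1 + eta * (z + z2))))^-1 / pi
    <= (Num.sqrt (1 - 2 * eta))^-1.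
Proof.
move=> rho eta eps0 epsE wE [z1N1 z12 z21 tp] [_ ->] eta1.
have z1I : -1 < z1 < 1 by rewrite z1N1 (lt_trans z12).
have z2I : -1 < z2 < 1 by rewrite z21 (lt_trans z1N1).
(* If b were 0, division by zero would make [epsilon] equal to 0, against [eps0]. *)
have b_neq0 : bcoef p D lambda != 0.
  apply: contraTneq eps0; rewrite -epsE /epsilon => ->.
  by rewrite expr0n/= invr0 mulr0 ltxx.
have [P VE] := V_wratioE b_neq0; rewrite epsE wE in VE.
have S_gt0 := shape_gt0 w z1I.
have rho_gt0 : 0 < rho by rewrite divr_gt0// one_sub_sqr_gt0.
have eta_gt0 : 0 < eta by rewrite divr_gt0// mulr_gt0.
have E1 : E = V p z1 D lambda by apply/(tp _ z1I); left.
have E2 : E = V p z2 D lambda by apply/(tp _ z2I); right.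
pose q z := 1 + eta * (z + z2).
have radE z : z1 <= z <= z2 -> (1 - z ^+ 2) * (E - V p z D lambda) =
    M / eta * ((z - z1) * (z2 - z) * q z).
  move=> /andP[z1z zz2].
  have zI : -1 < z < 1 by rewrite (lt_le_trans z1N1)// (le_lt_trans zz2).
  have := radicand_factor M_gt0 eps0 z1I z2I zI (negbT (lt_eqF z12)).
  by rewrite E1 !VE; apply; rewrite -!VE -E1.
have qI z : z1 <= z <= z2 -> 1 - 2 * eta <= q z <= 1 + 2 * eta.
  move=> /andP[z1z zz2]; rewrite /q; apply/andP; split; nra.
have cq : continuous q.
  move=> z; apply: cvgD; first exact: cvg_cst.
  by apply: cvgM; [exact: cvg_cst|apply: cvgD => //; exact: cvg_cst].
have lo0 : 0 < 1 - 2 * eta by rewrite subr_gt0.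
pose J := \int[@lebesgue_measure R]_(z in `[z1, z2])
  (Num.sqrt ((z - z1) * (z2 - z) * (1 + eta * (z + z2))))^-1.
have [iJ JI] : _ /\ pi / Num.sqrt (1 + 2 * eta) <= J <= pi / Num.sqrt (1 - 2 * eta)
  := arcsine_weight_bounds z12 cq lo0 qI.
rewrite -/J.
have Meta : 0 <= (M / eta)^-1 by rewrite invr_ge0 divr_ge0// ltW.
have -> : \int[@lebesgue_measure R]_(z in `[z1, z2])
        (Num.sqrt ((1 - z ^+ 2) * (E - V p z D lambda)))^-1 =
    Num.sqrt (M / eta)^-1 * J.
  rewrite -RintegralZl//; apply: eq_Rintegral => z; rewrite inE/= in_itv/= => zI.
  rewrite radE// sqrtrM; last by rewrite -invr_ge0.
  by rewrite invfM sqrtrV// -invr_ge0.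
split.
- rewrite leading_factorE; last exact: ltW.
  rewrite -/rho.
  have -> : rho * eps / (2 * M) = (M / eta)^-1.
    by rewrite /eta; field; rewrite !gt_eqF.
  have pi_neq0 : pi != 0 :> R by rewrite gt_eqF// pi_gt0.
  by rewrite -{1}[J](divfK pi_neq0); ring.
- rewrite ler_pdivlMr ?pi_gt0// ler_pdivrMr ?pi_gt0//.
  by rewrite ![_^-1 * pi]mulrC.
Qed.

End Top.

(** * The relative error and the asymptotic statement *)

(** The two sides reduce to (1 + x) (1 - x)^2 <= 1 and 1 <= (1 - x) (1 + x)^2; the second amounts to
    x (1 - x - x^2) >= 0, which x <= 1/2 ensures. *)
Lemma inv_sqrt_approx (R : rcfType) (x y : R) : 0 <= x <= 2^-1 ->
  (Num.sqrt (1 + x))^-1 <= y <= (Num.sqrt (1 - x))^-1 -> `|y - 1| <= x.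
Proof.
move=> /andP[x0 x1] /andP[lo hi]; rewrite ler_norml; apply/andP; split.
- rewrite lerBrDr addrC; apply: le_trans lo.
  rewrite -[leLHS]invrK lef_pV2 ?posrE ?sqrtr_gt0 ?invr_gt0; [|lra..].
  have h : 0 <= (1 - x)^-1 by rewrite invr_ge0; lra.
  rewrite -[leRHS]ger0_norm// -sqrtr_sqr ler_wsqrtr// exprVn.
  rewrite -[leRHS]mul1r ler_pdivlMr; last by rewrite exprn_gt0//; lra.
  nra.
- rewrite lerBlDr; apply: le_trans hi _.
  rewrite -[leRHS]invrK lef_pV2 ?posrE ?sqrtr_gt0 ?invr_gt0; [|lra..].
  have h : 0 <= (x + 1)^-1 by rewrite invr_ge0; lra.
  rewrite -[leLHS]ger0_norm// -sqrtr_sqr ler_wsqrtr// exprVn.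
  rewrite -[leLHS]mul1r ler_pdivrMr; last by rewrite exprn_gt0//; lra.
  nra.
Qed.

(** In the first claim [w] and [z1] are fixed and all other data are arbitrary functions of [eps],
    so the expansion holds along every such family. The constant obtained for the O term depends on
    [w] and [z1] only. *)
Theorem proposition3 (R : realType) (p : top_constants R)
    (mass_gt0 : 0 < mass p) (grav_gt0 : 0 < grav p)
    (radius_gt0 : 0 < top_radius p)
    (I1_gt0 : 0 < inertia1 p) (I3_gt0 : 0 < inertia3 p)
    (alpha_bounds : 0 < alpha p < 1)
    (gamma_bounds : 1 - alpha p ^+ 2 < gamma p < 1)
    (sigmaE : sigma p = (1 - gamma p) / (gamma p + alpha p ^+ 2 - 1)) :
  (forall (w z1 : R) (C lambda D E z2 zs : R -> R),
     (\forall eps \near 0^'+,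
        1 < C eps /\ lambda eps = C eps * lambda_thres p /\
        D1 p (lambda eps) < D eps < D0 p (lambda eps) /\
        (exists zmin : R, is_minimum_point p (D eps) (lambda eps) zmin /\
           V p zmin (D eps) (lambda eps) < E eps) /\
        turning_points p (D eps) (lambda eps) (E eps) z1 (z2 eps) /\
        mean_value_point p (D eps) (lambda eps) (E eps) z1 (z2 eps) (zs eps) /\
        wratio p (D eps) (lambda eps) = w /\
        epsilon p (D eps) (lambda eps) = eps) ->
     exists r : R -> R,
       r =O_ (0^'+) (fun eps : R => eps) /\
       \forall eps \near 0^'+,
         period p (D eps) (lambda eps) (E eps) z1 (z2 eps) =
         leading_factor p (zs eps) z1 w eps * (1 + r eps))
  /\
  (forall delta z1 w zs lambda D : R,
     0 < delta < 1 ->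
     -1 <= z1 <= 1 -> -1 + delta <= w <= 1 - delta -> -1 <= zs <= 1 ->
     0 < lambda -> D1 p lambda < D < D0 p lambda ->
     wratio p D lambda = w ->
     leading_factor p zs z1 w (epsilon p D lambda) <= T_max p D lambda).
Proof.
have /andP[alpha_gt0 alpha_lt1] := alpha_bounds.
have /andP[gamma_gt gamma_lt1] := gamma_bounds.
have gamma_gt0 : 0 < gamma p by rewrite divr_gt0.
have kappa_gt0 : 0 < kappa p by rewrite /kappa; lra.
split; last first.
  move=> delta z1 w zs lambda D /andP[delta_gt0 _] z1I /andP[w1 w2] zsI l0.
  move=> /andP[D1D _] _.
  by apply: leading_factor_le_T_max => //; apply/andP; split; lra.
move=> w z1 C lambda D E z2 zs H.
pose rho := (1 - z1 ^+ 2) / (1 + w ^+ 2 + 2 * w * z1).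
pose J eps := \int[@lebesgue_measure R]_(z in `[z1, z2 eps])
  (Num.sqrt ((z - z1) * (z2 eps - z) * (1 + rho * eps / 2 * (z + z2 eps))))^-1 / pi.
(* The sign of [rho] is known only once z1 is a turning point, hence the absolute value; adding 1
   makes the constant positive, so that it can be divided by. *)
have small : \forall eps \near 0^'+, (`|rho| + 1) * eps <= 2^-1.
  have c_gt0 : 0 < `|rho| + 1 by rewrite ltr_wpDl.
  near=> eps; rewrite mulrC -ler_pdivlMr//; apply/ltW.
  by near: eps; apply: nbhs_right_lt; rewrite divr_gt0.
have near_period : \forall eps \near 0^'+,
    `|J eps - 1| <= (`|rho| + 1) * `|eps| /\
    period p (D eps) (lambda eps) (E eps) z1 (z2 eps) =
      leading_factor p (zs eps) z1 w eps * J eps.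
  apply: filterS3 (nbhs_right_gt 0) small H => eps eps_gt0 eps_small.
  move=> [_ [_ [_ [_ [tp [mv [wE epsE]]]]]]].
  have rho_ge0 : 0 <= rho.
    have [z1N1 z12 z21 _] := tp.
    have z1I : -1 < z1 < 1 by rewrite z1N1 (lt_trans z12).
    by rewrite ltW// divr_gt0 ?one_sub_sqr_gt0 ?shape_gt0.
  rewrite (ger0_norm rho_ge0) (gtr0_norm eps_gt0) in eps_small *.
  have twoE : 2 * (rho * eps / 2) = rho * eps by field.
  have [] := @period_turning_points _ p mass_gt0 grav_gt0 radius_gt0 I3_gt0
    alpha_gt0 gamma_gt0 kappa_gt0 w z1 eps _ _ _ _ _ eps_gt0 epsE wE tp mv.
    by rewrite -/rho twoE; lra.
  rewrite -/rho twoE -/(J eps) => perE JI; split=> //.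
  apply: (@le_trans _ _ (rho * eps)); last by lra.
  apply: inv_sqrt_approx JI; rewrite mulr_ge0//=; lra.
(* [J] is the exact ratio of the period to the leading factor, so the error term is [J] - 1. *)
exists (fun eps => J eps - 1); split.
- apply/eqO_exP; exists (`|rho| + 1); first by rewrite ltr_wpDl.
  by apply: filterS near_period => eps [].
- by apply: filterS near_period => eps [_ ->]; rewrite addrC subrK.
Unshelve. all: by end_near. Qed.
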